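(* Let $n\ge 2$ and let $\mathfrak n\subseteq\mathfrak q(n)$ be the subalgebra spanned by all $\widetilde E_{ij}$ and $\overline E_{ij}$ with $1\le i<j\le n$. Then $$\dim\operatorname{H}^1(\mathfrak n,\mathbb C)=2(n-1).$$
   Context: All spaces are over $\mathbb C$. Rows and columns of matrices in $\mathfrak{gl}(n|n)$ are indexed by $\bar1,\dots,\bar n$ (even) and $1,\dots,n$ (odd), with elementary matrices $E_{ab}$ and the supercommutator bracket. $\mathfrak q(n)$ is the subalgebra of $\mathfrak{gl}(n|n)$ spanned by the even elements $\widetilde E_{ij}=E_{\bar i\bar j}+E_{ij}$ and the odd elements $\overline E_{ij}=E_{i\bar j}+E_{\bar i j}$, $1\le i,j\le n$. $\operatorname{H}^\bullet(\mathfrak n,\mathbb C)$ is the Lie superalgebra cohomology with trivial (even, one-dimensional) coefficients, i.e. the cohomology of the complex $C^p=\operatorname{Hom}(\Lambda_s^p(\mathfrak n),\mathbb C)$ with $\Lambda_s^p(\mathfrak n)=\bigoplus_{i+j=p}\Lambda^i(\mathfrak n_{\bar0})\otimes S^j(\mathfrak n_{\bar1})$ and differential $$df(\omega_0\wedge\cdots\wedge\omega_p)=\sum_{i<j}(-1)^{\sigma_{i,j}}f([\omega_i,\omega_j]\wedge\omega_0\wedge\cdots\widehat{\omega_i}\cdots\widehat{\omega_j}\cdots\wedge\omega_p),$$ $\sigma_{i,j}=i+j+|\omega_i||\omega_j|+|\omega_i|(|\omega_0|+\cdots+|\omega_{i-1}|)+|\omega_j|(|\omega_0|+\cdots+|\omega_{j-1}|)$.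 *)

(* Defs.v *)
From HB Require Import structures.
From mathcomp Require Import all_boot all_order all_algebra all_fingroup.
From mathcomp Require Import generic_quotient ring_quotient.
From mathcomp Require Import boolp functions.
From mathcomp Require Import reals complex ring zify.

Set Implicit Arguments.
Unset Strict Implicit.
Unset Printing Implicit Defensive.

Import GRing.Theory Num.Theory.
Local Open Scope ring_scope.
Local Open Scope quotient_scope.

(* MathComp's quotient of abelian groups, with its module structure. *)
Section QuotientModule.

Variables (R : pzRingType) (V : lmodType R) (S : {pred V}).
Hypothesis S_submod : submod_closed S.

Let zS : zmodClosed V :=
  HB.pack S (GRing.isZmodClosed.Build V S (GRing.submod_closedB S_submod)).

Definition quotmod := Quotient.quot zS.
HB.instance Definition _ := GRing.Zmodule.on quotmod.

Definition quotmod_pi : V -> quotmod := \pi_(Quotient.quot zS).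

Definition quotmod_scale (a : R) (x : quotmod) : quotmod :=
  quotmod_pi (a *: repr (x : Quotient.quot zS)).

Lemma quotmod_pi_eq x y : (quotmod_pi x == quotmod_pi y) = (x - y \in S).
Proof. by rewrite [RHS](@Quotient.idealrBE V zS). Qed.

Lemma quotmod_piK (x : quotmod) : quotmod_pi (repr (x : Quotient.quot zS)) = x.
Proof. exact: reprK. Qed.

Lemma quotmod_piD : {morph quotmod_pi : x y / x + y}.
Proof. by move=> x y; exact: Quotient.pi_add. Qed.

Lemma quotmod_piZ a x : quotmod_pi (a *: x) = quotmod_scale a (quotmod_pi x).
Proof.
apply/eqP; rewrite quotmod_pi_eq -scalerBr.
have [S0 SL] := S_submod; rewrite -[_ *: _]addr0; apply: SL => //.
by rewrite -quotmod_pi_eq quotmod_piK.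
Qed.

Fact quotmod_scaleA a b x :
  quotmod_scale a (quotmod_scale b x) = quotmod_scale (a * b) x.
Proof. by rewrite -[x]quotmod_piK -!quotmod_piZ scalerA. Qed.

Fact quotmod_scale1 : left_id 1 quotmod_scale.
Proof. by move=> x; rewrite -[x]quotmod_piK -quotmod_piZ scale1r. Qed.

Fact quotmod_scaleDr : right_distributive quotmod_scale +%R.
Proof.
move=> a x y; rewrite -[x]quotmod_piK -[y]quotmod_piK -quotmod_piD.
by rewrite -!quotmod_piZ scalerDr quotmod_piD.
Qed.

Fact quotmod_scaleDl x : {morph quotmod_scale^~ x : a b / a + b}.
Proof.
by move=> a b; rewrite -[x]quotmod_piK -!quotmod_piZ scalerDl quotmod_piD.
Qed.

HB.instance Definition _ := GRing.Zmodule_isLmodule.Build R quotmod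
  quotmod_scaleA quotmod_scale1 quotmod_scaleDr quotmod_scaleDl.

Lemma quotmod_pi_linear : linear quotmod_pi.
Proof. by move=> a x y; rewrite quotmod_piD quotmod_piZ. Qed.

HB.instance Definition _ :=
  GRing.isLinear.Build R V quotmod _ quotmod_pi quotmod_pi_linear.

End QuotientModule.

(* Finite-dimensional Lie superalgebras; parities are booleans, [true] is odd. *)
Record lieSuperalgebra (F : numFieldType) := LieSuperalgebra {
  lsa_sort :> vectType F;
  lsa_part : bool -> {vspace lsa_sort};
  lsa_br : lsa_sort -> lsa_sort -> lsa_sort;
  lsa_full : (lsa_part false + lsa_part true)%VS = fullv;
  lsa_cap : (lsa_part false :&: lsa_part true)%VS = 0%VS;
  lsa_linl : forall y, linear (lsa_br ^~ y);
  lsa_linr : forall x, linear (lsa_br x);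
  lsa_graded : forall a b x y, x \in lsa_part a -> y \in lsa_part b ->
    lsa_br x y \in lsa_part (a (+) b);
  lsa_skew : forall a b x y, x \in lsa_part a -> y \in lsa_part b ->
    lsa_br x y = - ((-1) ^+ (a && b) *: lsa_br y x);
  lsa_jacobi : forall a b c x y z,
    x \in lsa_part a -> y \in lsa_part b -> z \in lsa_part c ->
    lsa_br x (lsa_br y z) =
      lsa_br (lsa_br x y) z + (-1) ^+ (a && b) *: lsa_br y (lsa_br x z)
}.

Section Cohomology.

Variables (F : numFieldType) (L : lieSuperalgebra F).

(* Homogeneous component of parity [b]. *)
Definition hcomp (b : bool) : 'End(L) :=
  daddv_pi (lsa_part L b) (lsa_part L (~~ b)).

Lemma hcomp_id b x : x \in lsa_part L b -> hcomp b x = x.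
Proof.
move=> xb; apply: daddv_pi_id => //.
by case: b {xb}; rewrite ?[(lsa_part L true :&: _)%VS]capvC lsa_cap.
Qed.

Lemma hcomp_0 b x : x \in lsa_part L b -> hcomp (~~ b) x = 0.
Proof.
move=> xb; have cap0 : (lsa_part L b :&: lsa_part L (~~ b) = 0)%VS.
  by case: b {xb}; rewrite ?[(lsa_part L true :&: _)%VS]capvC lsa_cap.
have cap0' : (lsa_part L (~~ b) :&: lsa_part L b = 0)%VS by rewrite capvC.
have := @daddv_pi_add _ _ (lsa_part L b) (lsa_part L (~~ b)) x cap0.
rewrite (subvP (addvSl _ _) _ xb) => /(_ isT).
rewrite daddv_pi_id // => /(canRL (addKr _)); rewrite addNr => <-.
by rewrite /hcomp negbK.
Qed.

(* A linear form on [Lambda_s^p L] is the same thing as a [p]-linear form on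
   [L] that picks up the sign [- (-1) ^ (|x| |y|)] when two adjacent
   homogeneous arguments [x] and [y] are exchanged (2 is invertible in [F], so
   this is the alternating condition on even arguments).  Forms of both parities
   are included. *)
Definition multilinear_form p (f : ('I_p -> L) -> F^o) : Prop :=
  forall (k : 'I_p) (v : 'I_p -> L),
    linear (fun x : L => f (fun i => if i == k then x else v i)).

Definition superalternating p (f : ('I_p -> L) -> F^o) : Prop :=
  forall (e : 'I_p -> bool) (v : 'I_p -> L) (i j : 'I_p),
    (forall k, v k \in lsa_part L (e k)) -> j = i.+1 :> nat ->
    f (v \o tperm i j) = - ((-1) ^+ (e i && e j) *: f v).

Definition cochain p (f : ('I_p -> L) -> F^o) : Prop :=
  multilinear_form f /\ superalternating f.

(* For [i < j], the [p] arguments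
   [w_i, w_j], w_0, .., w_i omitted, .., w_j omitted, .., w_p:
   [bump j \o bump i] enumerates in order the indices other than [i] and [j]. *)
Definition contract p (i j : 'I_p.+1) (w : 'I_p.+1 -> L) : 'I_p -> L :=
  fun k => if k == 0 :> nat then lsa_br (w i) (w j)
           else w (inord (bump j (bump i k.-1))).

Definition sigma p (e : 'I_p.+1 -> bool) (i j : 'I_p.+1) : nat :=
  (i + j + e i * e j
   + e i * (\sum_(k < p.+1 | k < i) e k)
   + e j * (\sum_(k < p.+1 | k < j) e k))%N.

(* The differential on arguments [w] that are homogeneous of parities [e]. *)
Definition hdiff p (f : ('I_p -> L) -> F^o)
    (e : 'I_p.+1 -> bool) (w : 'I_p.+1 -> L) : F^o :=
  \sum_(i < p.+1) \sum_(j < p.+1 | (i < j)%N)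
    (-1) ^+ sigma e i j *: f (contract i j w).

(* Its multilinear extension to arbitrary arguments: see [diff_homogeneous]. *)
Definition diff p (f : ('I_p -> L) -> F^o) : ('I_p.+1 -> L) -> F^o :=
  fun w => \sum_(e : {ffun 'I_p.+1 -> bool}) hdiff f e (fun k => hcomp (e k) (w k)).

Lemma multilinear_form0 p (f : ('I_p -> L) -> F^o) v k :
  multilinear_form f -> v k = 0 -> f v = 0.
Proof.
move=> fL vk; have -> : v = fun i => if i == k then 0 else v i.
  by apply/funext => i; case: eqP => // ->.
have := fL k v (-1) 0 0; rewrite scaler0 addr0 => ->.
by rewrite scaleN1r addNr.
Qed.

Lemma lsa_br0l y : @lsa_br _ L 0 y = 0.
Proof. by have := @lsa_linl _ L y (-1) 0 0; rewrite scaler0 addr0 scaleN1r addNr. Qed.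

Lemma lsa_br0r x : @lsa_br _ L x 0 = 0.
Proof. by have := @lsa_linr _ L x (-1) 0 0; rewrite scaler0 addr0 scaleN1r addNr. Qed.

Lemma diff_homogeneous p (f : ('I_p -> L) -> F^o) e w :
    multilinear_form f -> (forall k, w k \in lsa_part L (e k)) ->
  diff f w = hdiff f e w.
Proof.
move=> fL wP; rewrite /diff (bigD1 (finfun e)) //= [X in _ + X]big1 => [|e' ne].
  rewrite addr0; congr hdiff; apply/funext => k; rewrite ffunE //.
  exact: hcomp_id.
have [k nek] : exists k, e' k != e k.
  apply/existsP; apply: contraNT ne; rewrite negb_exists => /forallP ee.
  by apply/eqP/ffunP => k; rewrite ffunE; apply/eqP; have := ee k; rewrite negbK.
set u := (fun m => hcomp (e' m) (w m)); have uk : u k = 0.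
  rewrite /u; have -> : e' k = ~~ e k by move: nek; case: (e' k); case: (e k).
  exact: hcomp_0.
rewrite /hdiff big1 // => i _; rewrite big1 // => j ij.
suff [m um] : exists m, contract i j u m = 0.
  by rewrite (multilinear_form0 fL um) scaler0.
have p_gt0 : (0 < p)%N.
  by have := ltn_ord j; rewrite ltnS; apply: leq_trans; apply: leq_trans ij.
have [ki|ki] := eqVneq k i.
  by exists (Ordinal p_gt0); rewrite /contract /= -ki uk lsa_br0l.
have [kj|kj] := eqVneq k j.
  by exists (Ordinal p_gt0); rewrite /contract /= -kj uk lsa_br0r.
have kE : k = bump j (bump i (unbump i (unbump j k))) :> nat.
  by move: ki kj; rewrite -!val_eqE /= /bump /unbump; lia.
have mP : ((unbump i (unbump j k)).+1 < p)%N.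
  move: ki kj (ltn_ord k) (ltn_ord j); rewrite -!val_eqE /= /unbump; lia.
exists (Ordinal mP); rewrite /contract /= -kE.
by rewrite inord_val.
Qed.

Lemma diff_linear p : linear (@diff p).
Proof.
move=> a f g; apply/funext => w.
transitivity (a *: diff f w + diff g w); last by [].
rewrite /diff scaler_sumr -big_split; apply: eq_bigr => e _.
rewrite /hdiff scaler_sumr -big_split; apply: eq_bigr => i _ /=.
rewrite scaler_sumr -big_split; apply: eq_bigr => j _ /=.
set u := contract _ _ _; transitivity ((-1) ^+ sigma e i j *: (a *: f u + g u)) => //.
by rewrite scalerDr !scalerA mulrC.
Qed.

Lemma cochain_submod p : submod_closed [pred f | `[<@cochain p f>]].
Proof.
split=> [|a f g /asboolP[fL fA] /asboolP[gL gA]]; apply/asboolP; split.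
- by move=> k v a x y; rewrite -[RHS]/(a *: 0 + 0) scaler0 addr0.
- by move=> e v i j _ _; rewrite -[RHS]/(- (_ *: 0)) scaler0 oppr0.
- move=> k v b x y; pose h (t : L) := fun i => if i == k then t else v i.
  change (a *: f (h (b *: x + y)) + g (h (b *: x + y)) =
    b *: (a *: f (h x) + g (h x)) + (a *: f (h y) + g (h y))).
  rewrite [f _]fL [g _]gL !scalerDr !scalerA [b * a]mulrC -!addrA.
  by congr (_ + _); rewrite addrCA.
- move=> e v i j eP ij; change (a *: f (v \o tperm i j) + g (v \o tperm i j)
    = - ((-1) ^+ (e i && e j) *: (a *: f v + g v))).
  by rewrite (fA e) // (gA e) // scalerDr opprD scalerN !scalerA [a * _]mulrC.
Qed.

Definition is_cocycle p : {pred ('I_p -> L) -> F^o} :=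
  [pred f | `[<cochain f /\ diff f = 0>]].

Lemma is_cocycle_submod p : submod_closed (@is_cocycle p).
Proof.
have [C0 CL] := cochain_submod p.
split=> [|a f g /asboolP[fC df] /asboolP[gC dg]]; apply/asboolP; split.
- exact/asboolP.
- by have := @diff_linear p (-1) 0 0; rewrite scaler0 addr0 scaleN1r addNr.
- by apply/asboolP; apply: CL; apply/asboolP.
- by rewrite diff_linear df dg scaler0 addr0.
Qed.

HB.instance Definition _ p := GRing.isSubmodClosed.Build F
  (('I_p -> L) -> F^o) (@is_cocycle p) (is_cocycle_submod p).

Record cocycle p := Cocycle {
  cocycle_form :> ('I_p -> L) -> F^o;
  cocycleP : cocycle_form \in @is_cocycle p
}.
HB.instance Definition _ p := [isSub for @cocycle_form p].
HB.instance Definition _ p := [Choice of cocycle p by <:].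
HB.instance Definition _ p := [SubChoice_isSubLmodule of cocycle p by <:].

Definition is_coboundary p : {pred cocycle p} :=
  match p return {pred cocycle p} with
  | 0 => [pred f | f == 0]
  | q.+1 => [pred f : cocycle q.+1 |
      `[<exists2 g : ('I_q -> L) -> F^o, cochain g & cocycle_form f = diff g>]]
  end.

Lemma is_coboundary_submod p : submod_closed (@is_coboundary p).
Proof.
case: p => [|q]; split; rewrite ?inE //=.
- by move=> a f g; rewrite !inE => /eqP-> /eqP->; rewrite scaler0 addr0.
- have [C0 _] := cochain_submod q; apply/asboolP; exists 0; first exact/asboolP.
  by have := @diff_linear q (-1) 0 0; rewrite scaler0 addr0 scaleN1r addNr.
- move=> a f g /asboolP[f' fC fE] /asboolP[g' gC gE].
  have [_ CL] := cochain_submod q.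
  apply/asboolP; exists (a *: f' + g').
    by apply/asboolP; apply: CL; apply/asboolP.
  by rewrite diff_linear -fE -gE.
Qed.

Definition cohomology p : lmodType F := quotmod (@is_coboundary_submod p).

End Cohomology.

(* [Vector.axiom d V] is the type of linear bijections from [V] to ['rV_d]. *)
Definition has_dim (R : nzRingType) (V : lmodType R) (d : nat) : Prop :=
  inhabited (Vector.axiom d V).

Section Subalgebra.

Variables (F : numFieldType) (g : lieSuperalgebra F) (U : {vspace g}).

(* Graded subspaces closed under the bracket. *)
Definition subalgebra : Prop :=
  (forall b x, x \in U -> hcomp g b x \in U) /\
  (forall x y, x \in U -> y \in U -> lsa_br x y \in U).

Hypothesis U_sub : subalgebra.

Definition sub_part (b : bool) : {vspace subvs_of U} :=
  (linfun (vsval : subvs_of U -> g) @^-1: lsa_part g b)%VS.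

Definition sub_br (x y : subvs_of U) : subvs_of U :=
  vsproj U (lsa_br (vsval x) (vsval y)).

Lemma mem_sub_part b x : (x \in sub_part b) = (vsval x \in lsa_part g b).
Proof. by rewrite -memv_preim lfunE. Qed.

Lemma sub_brE x y : vsval (sub_br x y) = lsa_br (vsval x) (vsval y).
Proof. by rewrite vsprojK //; apply: (proj2 U_sub); apply: subvsP. Qed.

Fact sub_full : (sub_part false + sub_part true)%VS = fullv.
Proof.
apply/eqP; rewrite eqEsubv subvf; apply/subvP => x _.
have xU b : hcomp g b (vsval x) \in U by apply: (proj1 U_sub); apply: subvsP.
have -> : x = vsproj U (hcomp g false (vsval x)) + vsproj U (hcomp g true (vsval x)).
  apply: subvs_inj; rewrite /= !vsprojK // /hcomp daddv_pi_add ?lsa_cap //.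
  by rewrite lsa_full memvf.
by apply: memv_add; rewrite mem_sub_part vsprojK //; apply: memv_pi.
Qed.

Fact sub_cap : (sub_part false :&: sub_part true)%VS = 0%VS.
Proof.
apply/eqP; rewrite -subv0; apply/subvP => x; rewrite memv_cap !mem_sub_part.
by rewrite -memv_cap lsa_cap !memv0 => /eqP x0; apply/eqP/subvs_inj.
Qed.

Fact sub_linl y : linear (sub_br ^~ y).
Proof.
move=> a u v; apply: subvs_inj.
change (vsval (sub_br (a *: u + v) y) = vsval (a *: sub_br u y + sub_br v y)).
by rewrite sub_brE 2!linearP /= !sub_brE; apply: lsa_linl.
Qed.

Fact sub_linr x : linear (sub_br x).
Proof.
move=> a u v; apply: subvs_inj.
change (vsval (sub_br x (a *: u + v)) = vsval (a *: sub_br x u + sub_br x v)).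
by rewrite sub_brE 2!linearP /= !sub_brE; apply: lsa_linr.
Qed.

Fact sub_graded a b x y : x \in sub_part a -> y \in sub_part b ->
  sub_br x y \in sub_part (a (+) b).
Proof. by rewrite !mem_sub_part sub_brE; apply: lsa_graded. Qed.

Fact sub_skew a b x y : x \in sub_part a -> y \in sub_part b ->
  sub_br x y = - ((-1) ^+ (a && b) *: sub_br y x).
Proof.
rewrite !mem_sub_part => xa yb; apply: subvs_inj.
by rewrite -scalerN linearZ linearN /= !sub_brE scalerN; apply: lsa_skew.
Qed.

Fact sub_jacobi a b c x y z :
  x \in sub_part a -> y \in sub_part b -> z \in sub_part c ->
  sub_br x (sub_br y z) =
    sub_br (sub_br x y) z + (-1) ^+ (a && b) *: sub_br y (sub_br x z).
Proof.
rewrite !mem_sub_part => xa yb zc; apply: subvs_inj.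
rewrite linearD linearZ /= !sub_brE; exact: lsa_jacobi xa yb zc.
Qed.

Definition sub_lsa : lieSuperalgebra F :=
  LieSuperalgebra sub_full sub_cap sub_linl sub_linr sub_graded sub_skew
    sub_jacobi.

End Subalgebra.

Section GeneralLinear.

Variables (F : numFieldType) (n : nat).

Local Notation gl := 'M[F]_(n + n).

(* The even index [bar i] is [lshift n i], the odd index [i] is [rshift n i]. *)
Definition ipar (i : 'I_(n + n)) : bool := (n <= i)%N.

Definition gl_part (b : bool) : {vspace gl} :=
  (\sum_(p : 'I_(n + n) * 'I_(n + n) | ipar p.1 (+) ipar p.2 == b)
     <[delta_mx p.1 p.2 : gl]>)%VS.

Definition gl_comp (b : bool) (A : gl) : gl :=
  \matrix_(i, j) if ipar i (+) ipar j == b then A i j else 0.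

(* [AB - (-1) ^ (|A| |B|) BA] on homogeneous matrices, extended bilinearly:
   see [supercommE]. *)
Definition supercomm (A B : gl) : gl :=
  \sum_(a : bool) \sum_(b : bool)
    (gl_comp a A *m gl_comp b B - (-1) ^+ (a && b) *: (gl_comp b B *m gl_comp a A)).

Lemma gl_partP b A : (A \in gl_part b) = (gl_comp b A == A).
Proof.
apply/idP/eqP => [/memv_sumP[X XP ->]|<-].
  apply/matrixP => i j; rewrite mxE !summxE; case: ifP => // ij.
  rewrite big1 // => p pb; have /vlineP[k ->] := XP p pb.
  rewrite !mxE; case: eqP => [ip|]; case: eqP => [jp|]; rewrite ?mulr0 //.
  by rewrite -ip -jp ij in pb.
rewrite [gl_comp b A]matrix_sum_delta pair_big /= (bigID (fun p => ipar p.1 (+) ipar p.2 == b)) /=.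
rewrite [X in _ + X]big1 ?addr0 => [|p /negPf pb]; last by rewrite mxE pb scale0r.
by apply: memv_sumr => p _; apply: memvZ; apply: memv_line.
Qed.

Lemma gl_comp_linear b : linear (gl_comp b).
Proof. by move=> a A B; apply/matrixP => i j; rewrite !mxE; case: ifP => // _; rewrite mulr0 addr0. Qed.

HB.instance Definition _ b :=
  GRing.isLinear.Build F gl gl _ (gl_comp b) (gl_comp_linear b).

Lemma gl_comp_sum A : gl_comp false A + gl_comp true A = A.
Proof.
apply/matrixP => i j; rewrite !mxE.
by case: (ipar i (+) ipar j); rewrite /= ?addr0 ?add0r.
Qed.

Lemma gl_comp_comp a b A : gl_comp a (gl_comp b A) = if a == b then gl_comp b A else 0.
Proof.
apply/matrixP => i j; case: eqP => [->|/eqP ab]; rewrite !mxE; case: eqP => // ->.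
by rewrite (negPf ab).
Qed.

Lemma supercommE a b A B : A \in gl_part a -> B \in gl_part b ->
  supercomm A B = A *m B - (-1) ^+ (a && b) *: (B *m A).
Proof.
rewrite !gl_partP => /eqP AE /eqP BE.
have hA c : gl_comp c A = if c == a then A else 0 by rewrite -{1}AE gl_comp_comp AE.
have hB c : gl_comp c B = if c == b then B else 0 by rewrite -{1}BE gl_comp_comp BE.
rewrite /supercomm !big_bool /= !hA !hB; clear.
by case: a; case: b; rewrite /= ?mul0mx ?mulmx0 ?scaler0 ?subr0 ?addr0 ?add0r.
Qed.

Lemma mulmx_part a b A B : A \in gl_part a -> B \in gl_part b ->
  A *m B \in gl_part (a (+) b).
Proof.
rewrite !gl_partP => /eqP AE /eqP BE; apply/eqP/matrixP => i j.
rewrite mxE; case: eqP => // ij; rewrite mxE big1 // => k _.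
rewrite -AE -BE !mxE; case: eqP => [ik|]; case: eqP => [kj|]; rewrite ?mul0r ?mulr0 //.
by case: ij; rewrite -ik -kj; case: (ipar i); case: (ipar j); case: (ipar k).
Qed.

Fact gl_full : (gl_part false + gl_part true)%VS = fullv.
Proof.
apply/eqP; rewrite eqEsubv subvf; apply/subvP => A _; rewrite -(gl_comp_sum A).
by apply: memv_add; rewrite gl_partP gl_comp_comp eqxx.
Qed.

Fact gl_cap : (gl_part false :&: gl_part true)%VS = 0%VS.
Proof.
apply/eqP; rewrite -subv0; apply/subvP => A; rewrite memv_cap !gl_partP memv0.
by case/andP => /eqP AE /eqP BE; rewrite -AE -BE gl_comp_comp.
Qed.

Fact supercomm_linl B : linear (supercomm ^~ B).
Proof.
move=> c A A'; rewrite /supercomm scaler_sumr -big_split; apply: eq_bigr => a _.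
rewrite scaler_sumr -big_split; apply: eq_bigr => b _ /=.
rewrite linearP mulmxDl mulmxDr -scalemxAl -scalemxAr scalerBr scalerDr.
by rewrite !scalerA [c * _]mulrC opprD addrACA.
Qed.

Fact supercomm_linr A : linear (supercomm A).
Proof.
move=> c B B'; rewrite /supercomm scaler_sumr -big_split; apply: eq_bigr => a _.
rewrite scaler_sumr -big_split; apply: eq_bigr => b _ /=.
rewrite linearP mulmxDl mulmxDr -scalemxAl -scalemxAr scalerBr scalerDr.
by rewrite !scalerA [c * _]mulrC opprD addrACA.
Qed.

Fact supercomm_graded a b A B : A \in gl_part a -> B \in gl_part b ->
  supercomm A B \in gl_part (a (+) b).
Proof.
move=> Aa Bb; rewrite (supercommE Aa Bb) rpredB ?rpredZ //; first exact: mulmx_part.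
by rewrite addbC; apply: mulmx_part.
Qed.

Fact supercomm_skew a b A B : A \in gl_part a -> B \in gl_part b ->
  supercomm A B = - ((-1) ^+ (a && b) *: supercomm B A).
Proof.
move=> Aa Bb; rewrite (supercommE Aa Bb) (supercommE Bb Aa) andbC.
by rewrite scalerBr scalerA -expr2 sqrr_sign scale1r opprB.
Qed.

Fact supercomm_jacobi a b c A B C :
  A \in gl_part a -> B \in gl_part b -> C \in gl_part c ->
  supercomm A (supercomm B C) =
    supercomm (supercomm A B) C + (-1) ^+ (a && b) *: supercomm B (supercomm A C).
Proof.
move=> Aa Bb Cc.
rewrite (supercommE Aa (supercomm_graded Bb Cc)).
rewrite (supercommE (supercomm_graded Aa Bb) Cc).
rewrite (supercommE Bb (supercomm_graded Aa Cc)).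
rewrite (supercommE Aa Bb) (supercommE Aa Cc) (supercommE Bb Cc).
rewrite !(mulmxBl, mulmxBr, scalerBr) -?scalemxAl -?scalemxAr !mulmxA.
move: (A *m B *m C) (A *m C *m B) (B *m A *m C) => X1 X2 X3.
move: (B *m C *m A) (C *m A *m B) (C *m B *m A) => X4 X5 X6.
by apply/matrixP => i j; rewrite !mxE; case: a {Aa}; case: b {Bb}; case: c {Cc} => /=; ring.
Qed.

Definition gl_lsa : lieSuperalgebra F :=
  LieSuperalgebra gl_full gl_cap supercomm_linl supercomm_linr supercomm_graded
    supercomm_skew supercomm_jacobi.

End GeneralLinear.

Section Queer.

Variables (F : numFieldType) (n : nat).

Local Notation gl := (gl_lsa F n).

Definition Etilde (i j : 'I_n) : gl :=
  delta_mx (lshift n i) (lshift n j) + delta_mx (rshift n i) (rshift n j)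
    :> 'M[F]_(n + n).

Definition Ebar (i j : 'I_n) : gl :=
  delta_mx (lshift n i) (rshift n j) + delta_mx (rshift n i) (lshift n j)
    :> 'M[F]_(n + n).

Definition q_space : {vspace gl} :=
  (\sum_(p : 'I_n * 'I_n) (<[Etilde p.1 p.2]> + <[Ebar p.1 p.2]>))%VS.

Definition nil_space : {vspace gl} :=
  (\sum_(p : 'I_n * 'I_n | (p.1 < p.2)%N) (<[Etilde p.1 p.2]> + <[Ebar p.1 p.2]>))%VS.

Lemma nil_sub_q : (nil_space <= q_space)%VS.
Proof.
apply/subv_sumP => p _; apply: subv_trans (addvS (subvv _) (subvv _)) _.
exact: (sumv_sup p).
Qed.

Definition upper (A : 'M[F]_n) := forall i j : 'I_n, (j <= i)%N -> A i j = 0.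

Lemma upperM A B : upper A -> upper B -> upper (A *m B).
Proof.
move=> Au Bu i j ji; rewrite mxE big1 // => k _.
have [ki|ik] := leqP k i; first by rewrite Au ?mul0r.
by rewrite Bu ?mulr0 // (leq_trans ji) // ltnW.
Qed.

Lemma upper0 : upper 0.
Proof. by move=> i j _; rewrite mxE. Qed.

Lemma upperP a A B : upper A -> upper B -> upper (a *: A + B).
Proof. by move=> Au Bu i j ji; rewrite !mxE Au // Bu // mulr0 addr0. Qed.

Lemma upperD A B : upper A -> upper B -> upper (A + B).
Proof. by move=> Au Bu; rewrite -[A]scale1r; apply: upperP. Qed.

Lemma upperB A B : upper A -> upper B -> upper (A - B).
Proof. by move=> Au Bu; rewrite addrC -scaleN1r; apply: upperP. Qed.

Lemma EtildeE i j : Etilde i j = block_mx (delta_mx i j) 0 0 (delta_mx i j).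
Proof.
apply/matrixP => k l; rewrite mxE -(fintype.splitK k) -(fintype.splitK l).
by case: (fintype.split k) => k'; case: (fintype.split l) => l';
  rewrite /= ?(block_mxEul, block_mxEur, block_mxEdl, block_mxEdr) !mxE
    ?(eq_lshift, eq_rshift, eq_lrshift, eq_rlshift) ?andbF ?addr0 ?add0r.
Qed.

Lemma EbarE i j : Ebar i j = block_mx 0 (delta_mx i j) (delta_mx i j) 0.
Proof.
apply/matrixP => k l; rewrite mxE -(fintype.splitK k) -(fintype.splitK l).
by case: (fintype.split k) => k'; case: (fintype.split l) => l';
  rewrite /= ?(block_mxEul, block_mxEur, block_mxEdl, block_mxEdr) !mxE
    ?(eq_lshift, eq_rshift, eq_lrshift, eq_rlshift) ?andbF ?addr0 ?add0r.
Qed.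

Lemma nil_combE a b i j : a *: Etilde i j + b *: Ebar i j =
  block_mx (a *: delta_mx i j) (b *: delta_mx i j)
    (b *: delta_mx i j) (a *: delta_mx i j).
Proof.
rewrite EtildeE EbarE [a *: _]scale_block_mx [b *: _]scale_block_mx.
by rewrite [LHS]add_block_mx !scaler0 !addr0 !add0r.
Qed.

Lemma upper_delta a (i j : 'I_n) : (i < j)%N -> upper (a *: delta_mx i j).
Proof.
move=> ij k l lk; rewrite !mxE; case: eqP => [ki|]; case: eqP => [lj|];
  rewrite ?mulr0 //.
by move: ij; rewrite -ki -lj ltnNge lk.
Qed.

Lemma nil_spaceP (X : 'M[F]_(n + n)) : X \in nil_space <->
  exists A B : 'M[F]_n, [/\ upper A, upper B & X = block_mx A B B A].
Proof.
split=> [/memv_sumP[Y YP ->]|[A [B [Au Bu ->]]]].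
  pose P (Z : 'M[F]_(n + n)) :=
    exists A B : 'M[F]_n, [/\ upper A, upper B & Z = block_mx A B B A].
  apply: (big_ind P) => [|Z Z' [A [B [Au Bu ->]]] [A' [B' [Au' Bu' ->]]]|p pP].
  - by exists 0, 0; split; rewrite ?block_mx_const; try exact: upper0.
  - exists (A + A'), (B + B'); split; try exact: upperD.
    by rewrite add_block_mx.
  have /memv_addP[_ /vlineP[a ->] [_ /vlineP[b ->] ->]] := YP p pP.
  exists (a *: delta_mx p.1 p.2), (b *: delta_mx p.1 p.2).
  split; try exact: upper_delta.
  exact: nil_combE.
have -> : block_mx A B B A = \sum_(p : 'I_n * 'I_n | (p.1 < p.2)%N)
    (A p.1 p.2 *: Etilde p.1 p.2 + B p.1 p.2 *: Ebar p.1 p.2) :> gl.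
  have ED (C : 'M[F]_n) : upper C ->
      C = \sum_(p : 'I_n * 'I_n | (p.1 < p.2)%N) C p.1 p.2 *: delta_mx p.1 p.2.
    move=> Cu; rewrite {1}(matrix_sum_delta C) pair_big /=.
    rewrite (bigID (fun p : 'I_n * 'I_n => (p.1 < p.2)%N)) /=.
    by rewrite [X in _ + X]big1 ?addr0 // => p; rewrite -leqNgt => /Cu->; rewrite scale0r.
  rewrite {1 2}(ED A Au) {1 2}(ED B Bu).
  apply: (big_rec3 (fun x y z => block_mx x y y x = z)) => [|p x y z _ <-].
    by rewrite block_mx_const.
  by rewrite nil_combE [RHS]add_block_mx.
by apply: memv_sumr => p _; apply: memv_add; apply: memvZ; apply: memv_line.
Qed.

Lemma hcomp_gl b (A : gl) : hcomp gl b A = gl_comp b A.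
Proof.
have mem c : gl_comp c A \in lsa_part gl c.
  by rewrite /= gl_partP gl_comp_comp eqxx.
have AE : gl_comp b A + gl_comp (~~ b) A = A.
  by have := gl_comp_sum A; case: b {mem} => //=; rewrite addrC.
rewrite -[X in hcomp gl b X]AE linearD /= (hcomp_id (mem b)); have := hcomp_0 (mem (~~ b)).
by rewrite negbK => ->; rewrite addr0.
Qed.

Lemma gl_comp_block b (A B C D : 'M[F]_n) :
  gl_comp b (block_mx A B C D) =
    if b then block_mx 0 B C 0 else block_mx A 0 0 D.
Proof.
apply/matrixP => k l; rewrite mxE -(fintype.splitK k) -(fintype.splitK l).
by case: (fintype.split k) => k'; case: (fintype.split l) => l'; case: b;
  rewrite /= ?(block_mxEul, block_mxEur, block_mxEdl, block_mxEdr) ?mxE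
    /ipar /= ?leq_addr ?[(n <= nat_of_ord _)%N]leqNgt ?ltn_ord.
Qed.

Lemma supercomm_q (A B A' B' : 'M[F]_n) :
  supercomm (block_mx A B B A) (block_mx A' B' B' A') =
    block_mx (A *m A' - A' *m A + (B *m B' + B' *m B))
      (A *m B' - B' *m A + (B *m A' - A' *m B))
      (A *m B' - B' *m A + (B *m A' - A' *m B))
      (A *m A' - A' *m A + (B *m B' + B' *m B)).
Proof.
rewrite /supercomm !big_bool /= !gl_comp_block !mulmx_block.
rewrite !(mul0mx, mulmx0, addr0, add0r) !scale_block_mx !opp_block_mx.
rewrite !add_block_mx !scaler0 !(subr0, oppr0, addr0, add0r).
rewrite expr1 expr0 !scaleN1r !opprK !scale1r.
congr block_mx; apply/matrixP => i j.
all: rewrite !mxE; ring.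
Qed.

Lemma nil_subalgebra : subalgebra nil_space.
Proof.
split=> [b X|X Y].
  move=> /nil_spaceP[A [B [Au Bu ->]]]; rewrite hcomp_gl gl_comp_block.
  apply/nil_spaceP; case: b; [exists 0, B | exists A, 0]; split=> //; exact: upper0.
move=> /nil_spaceP[A [B [Au Bu ->]]] /nil_spaceP[A' [B' [Au' Bu' ->]]].
apply/nil_spaceP; rewrite [lsa_br _ _]supercomm_q; do 2![eexists]; split; last by [].
- by apply: upperD; [apply: upperB | apply: upperD]; apply: upperM.
- by apply: upperD; apply: upperB; apply: upperM.
Qed.

Definition nil_lsa : lieSuperalgebra F := sub_lsa nil_subalgebra.

End Queer.

(* Main.v *)
(** Coboundaries of degree 1 vanish, so [H^1] is the space of linear forms on
    [n] that kill [n, n].  The brackets of the generators produce every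
    [Etilde i j] and [Ebar i j] with [i + 1 < j], whereas the two
    superdiagonals, read off at the entries [(i, i + 1)] of the even and of the
    odd block, vanish on brackets because products of strictly upper triangular
    matrices do.  So n / [n, n] has the two superdiagonals as coordinates. *)
From HB Require Import structures.
Require Import Defs.
From mathcomp Require Import all_boot all_order all_algebra.
From mathcomp Require Import boolp functions.
From mathcomp Require Import reals complex.

Set Implicit Arguments.
Unset Strict Implicit.
Unset Printing Implicit Defensive.

Import GRing.Theory.
Local Open Scope ring_scope.

(** * Degree one cohomology of a finite-dimensional Lie superalgebra *)

Section FirstCohomology.

Variables (F : numFieldType) (L : lieSuperalgebra F).

Lemma hcomp_sum (x : L) : hcomp L false x + hcomp L true x = x.
Proof. by rewrite /hcomp daddv_pi_add ?lsa_cap ?lsa_full ?memvf. Qed.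

Lemma hcomp_mem b (x : L) : hcomp L b x \in lsa_part L b.
Proof. exact: memv_pi. Qed.

Lemma lsa_brDl (x x' y : L) : lsa_br (x + x') y = lsa_br x y + lsa_br x' y.
Proof. by have := lsa_linl y 1 x x'; rewrite !scale1r. Qed.

Lemma lsa_brDr (x y y' : L) : lsa_br x (y + y') = lsa_br x y + lsa_br x y'.
Proof. by have := lsa_linr x 1 y y'; rewrite !scale1r. Qed.

Lemma ord1_fun (T : Type) (v : 'I_1 -> T) : v = fun=> v ord0.
Proof. by apply/funext => k; rewrite ord1. Qed.

(** With one argument there are no two adjacent positions, so the sign rule is vacuous. *)
Lemma cochain1P (f : ('I_1 -> L) -> F^o) :
  cochain f <-> linear (fun x => f (fun=> x)).
Proof.
have upd (v : 'I_1 -> L) k x : (fun i => if i == k then x else v i) = fun=> x.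
  by apply/funext => i; rewrite !ord1.
split=> [[fL _] a x y|fL].
  by have := fL ord0 (fun=> 0) a x y; rewrite !upd.
split=> [k v a x y|e v i j _]; first by rewrite !upd fL.
by rewrite !ord1.
Qed.

(** Only the pair (0, 1) contributes. In its sign the product of the two parities occurs twice, once
    directly and once from moving the second argument past the first, so the sign is -1 for all
    parities. *)
Lemma hdiff1 (f : ('I_1 -> L) -> F^o) e w :
  hdiff f e w = - f (fun=> lsa_br (w ord0) (w ord_max)).
Proof.
rewrite /hdiff big_ord_recl big_ord1 [X in _ + X]big_pred0 => [|j]; last first.
  by rewrite ltnNge -ltnS ltn_ord.
rewrite big_mkcond /= big_ord_recl big_ord1 /= addr0 add0r.
rewrite (_ : lift ord0 ord0 = ord_max); last exact: val_inj.
have -> : contract ord0 ord_max w = fun=> lsa_br (w ord0) (w ord_max).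
  by rewrite [LHS]ord1_fun.
have -> : sigma e ord0 ord_max = (1 + (e ord0 * e ord_max).*2)%N.
  rewrite /sigma big_pred0 // big_mkcond /= !big_ord_recl big_ord0 /=.
  by rewrite !addn0 muln0 addn0 -addnn [(e ord_max * _)%N]mulnC addnA.
by rewrite exprD -mul2n exprM sqrrN !expr1n mulr1 expr1 scaleN1r.
Qed.

Lemma diff1_eq0 (f : ('I_1 -> L) -> F^o) : cochain f ->
  diff f = 0 <-> forall x y : L, f (fun=> lsa_br x y) = 0.
Proof.
move=> fC; have /cochain1P fL := fC; have [fM _] := fC.
have fD x y : f (fun=> x + y) = f (fun=> x) + f (fun=> y).
  by have := fL 1 x y; rewrite !scale1r.
split=> [df0|f0]; last first.
  by apply/funext => w; rewrite /diff big1 // => e _; rewrite hdiff1 f0 oppr0.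
(* On homogeneous arguments [diff f] is minus [f] of the bracket; bilinearity then covers all
   arguments. *)
have hom a b x y : f (fun=> lsa_br (hcomp L a x) (hcomp L b y)) = 0.
  pose e (k : 'I_2) := if k == ord0 then a else b.
  pose w (k : 'I_2) := if k == ord0 then hcomp L a x else hcomp L b y.
  have wP k : w k \in lsa_part L (e k).
    by rewrite /w /e; case: ifP => _; apply: hcomp_mem.
  apply: oppr_inj; rewrite oppr0 -[LHS](hdiff1 f e w).
  by rewrite -(diff_homogeneous fM wP) df0.
move=> x y; rewrite -(hcomp_sum x) -(hcomp_sum y) lsa_brDl !lsa_brDr !fD.
by rewrite !hom !addr0.
Qed.

Lemma cocycle1P (f : ('I_1 -> L) -> F^o) : f \in @is_cocycle F L 1 <->
  linear (fun x => f (fun=> x)) /\ forall x y : L, f (fun=> lsa_br x y) = 0.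
Proof.
split=> [/asboolP[fC /(diff1_eq0 fC) f0]|[fL f0]]; first by split=> //; apply/cochain1P.
have fC : cochain f by apply/cochain1P.
by apply/asboolP; split=> //; apply/diff1_eq0.
Qed.

(** A single argument leaves no pair to contract, so the sum is empty. *)
Lemma diff0 (g : ('I_0 -> L) -> F^o) : diff g = 0.
Proof.
apply/funext => w; rewrite /diff big1 // => e _; rewrite /hdiff big1 // => i _.
by rewrite big1 // => j; rewrite !ord1.
Qed.

Lemma coboundary1 (f : cocycle L 1) : (f \in @is_coboundary F L 1) = (f == 0).
Proof.
apply/asboolP/eqP => [[g _ fE]|->]; first by apply: val_inj; rewrite /= fE diff0.
exists 0; last by rewrite diff0.
by apply/asboolP; have [] := cochain_submod L 0.
Qed.

(* [c] is the basis of [(L / [L, L])^*] dual to the images of the [b i]. *)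
Lemma cohomology1_has_dim (I : finType) (b : I -> L) (c : I -> L -> F^o) :
    (forall i, linear (c i)) ->
    (forall i x y, c i (lsa_br x y) = 0) ->
    (forall i j, c i (b j) = (i == j)%:R) ->
    (forall f : L -> F^o, linear f -> (forall x y, f (lsa_br x y) = 0) ->
      (forall i, f (b i) = 0) -> forall x, f x = 0) ->
  has_dim (cohomology L 1) #|I|.
Proof.
move=> cL c_br cb cI.
have form_in (r : 'rV[F]_#|I|) :
    (fun w : 'I_1 -> L => \sum_i r 0 (enum_rank i) *: c i (w ord0) : F^o)
      \in @is_cocycle F L 1.
  apply/cocycle1P; split=> [a x y|x y]; last first.
    by rewrite big1 // => i _; rewrite c_br scaler0.
  rewrite scaler_sumr -big_split; apply: eq_bigr => i _ /=.
  by rewrite cL scalerDr !scalerA mulrC.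
pose coord (f : cocycle L 1) : 'rV[F]_#|I| := \row_k f (fun=> b (enum_val k)).
have coordL : linear coord by move=> a f g; apply/rowP => k; rewrite !mxE.
pose v2r (h : cohomology L 1) := coord (repr h).
(* The representative chosen in the class of [f] differs from [f] by a coboundary, hence by 0. *)
have reprP f : repr (quotmod_pi (is_coboundary_submod L 1) f) = f.
  apply/eqP; rewrite -subr_eq0 -coboundary1 -(quotmod_pi_eq (is_coboundary_submod L 1)).
  by rewrite quotmod_piK.
(* The difference of [f] and the sum of the [f (b i) *: c i] is linear, kills brackets and vanishes
   on every [b j], so [cI] applies to it. *)
have coordK f : Cocycle (form_in (coord f)) = f.
  have /cocycle1P[fL f0] := cocycleP f; apply/esym/val_inj => /=.
  apply/funext => w; rewrite [in LHS](ord1_fun w).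
  apply/eqP; rewrite -subr_eq0; apply/eqP; move: (w ord0).
  apply: cI => [a x y|x y|j].
  - rewrite fL; under eq_bigr do rewrite cL scalerDr scalerA mulrC -scalerA.
    by rewrite big_split /= -scaler_sumr scalerBr opprD addrACA.
  - by rewrite f0 big1 ?subr0 // => i _; rewrite c_br scaler0.
  rewrite (bigD1 j) //= big1 => [|i /negPf ij]; last by rewrite cb ij scaler0.
  by rewrite addr0 cb eqxx mxE enum_rankK [_ *: _]mulr1 subrr.
constructor; exists v2r.
  move=> a h k; rewrite /v2r -coordL; congr coord.
  rewrite -[in LHS](quotmod_piK h) -[in LHS](quotmod_piK k) -linearP.
  exact: reprP.
exists (fun r => quotmod_pi (is_coboundary_submod L 1) (Cocycle (form_in r))).
  by move=> h; rewrite coordK quotmod_piK.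
move=> r; rewrite /v2r reprP; apply/rowP => k; rewrite mxE /=.
rewrite (bigD1 (enum_val k)) //= big1 => [|i /negPf ij]; last by rewrite cb ij scaler0.
by rewrite addr0 cb eqxx enum_valK [_ *: _]mulr1.
Qed.

End FirstCohomology.

(** * Brackets, coordinates and generators of the strictly upper triangular subalgebra *)

Section Nilradical.

Variables (F : numFieldType) (n : nat).

Local Notation gl := (gl_lsa F n).
Local Notation nil := (nil_lsa F n).

Lemma Etilde_nil (i j : 'I_n) : (i < j)%N -> Etilde F i j \in nil_space F n.
Proof.
move=> ij; apply: (subvP (sumv_sup (i, j) ij (addvSl _ _))); exact: memv_line.
Qed.

Lemma Ebar_nil (i j : 'I_n) : (i < j)%N -> Ebar F i j \in nil_space F n.
Proof.
move=> ij; apply: (subvP (sumv_sup (i, j) ij (addvSr _ _))); exact: memv_line.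
Qed.

(** The product in the reverse order vanishes because i and j differ. *)
Lemma br_Etilde (i k j : 'I_n) : i != j ->
  lsa_br (Etilde F i k : gl) (Etilde F k j) = Etilde F i j.
Proof.
move=> ij; rewrite !EtildeE [LHS]supercomm_q !mul_delta_mx_cond eqxx eq_sym (negPf ij).
by rewrite !mulmx0 !mul0mx !(subr0, addr0).
Qed.

Lemma br_EtildeEbar (i k j : 'I_n) : i != j ->
  lsa_br (Etilde F i k : gl) (Ebar F k j) = Ebar F i j.
Proof.
move=> ij; rewrite !EtildeE !EbarE [LHS]supercomm_q !mul_delta_mx_cond.
by rewrite eqxx eq_sym (negPf ij) !mulmx0 !mul0mx !(subr0, addr0).
Qed.

(** A nonzero term [A i k * B k j] would need i < k < i + 1. *)
Lemma upperM_superdiag (A B : 'M[F]_n) (i j : 'I_n) : j = i.+1 :> nat ->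
  upper A -> upper B -> (A *m B) i j = 0.
Proof.
move=> ij Au Bu; rewrite mxE big1 // => k _.
by case: (leqP k i) => ik; [rewrite Au ?mul0r | rewrite Bu ?mulr0 ?ij].
Qed.

(** The bottom blocks repeat the top ones, so reading the top rows is enough; [b] selects the even
    or the odd block. *)
Definition block_coord (b : bool) (i j : 'I_n) (x : nil) : F^o :=
  (vsval x : 'M[F]_(n + n)) (lshift n i) (if b then rshift n j else lshift n j).

Lemma block_coord_linear b i j : linear (block_coord b i j).
Proof. by move=> a x y; rewrite /block_coord linearP !mxE. Qed.

Lemma block_coord_br b (i j : 'I_n) x y : j = i.+1 :> nat ->
  block_coord b i j (lsa_br x y) = 0.
Proof.
move=> ij; rewrite /block_coord /= (sub_brE (nil_subalgebra F n)).
have /nil_spaceP[A [B [Au Bu ->]]] := subvsP x.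
have /nil_spaceP[A' [B' [Au' Bu' ->]]] := subvsP y.
(* Rewriting with [mxE] would also expand the matrix products, which must stay intact for
   [upperM_superdiag]. *)
have addE (M N : 'M[F]_n) : (M + N) i j = M i j + N i j by rewrite mxE.
have oppE (M : 'M[F]_n) : (- M) i j = - M i j by rewrite mxE.
rewrite [lsa_br _ _]supercomm_q; case: b; rewrite (block_mxEur, block_mxEul).
all: by rewrite !(addE, oppE) !upperM_superdiag // !(oppr0, addr0).
Qed.

(** The projection makes this total; it is the intended generator when i < j. *)
Definition nil_gen (b : bool) (i j : 'I_n) : nil :=
  vsproj (nil_space F n) (if b then Ebar F i j else Etilde F i j).

Lemma nil_gen_val b (i j : 'I_n) : (i < j)%N ->
  vsval (nil_gen b i j) = if b then Ebar F i j else Etilde F i j.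
Proof. by move=> ij; rewrite vsprojK //; case: b; rewrite (Ebar_nil, Etilde_nil). Qed.

(** An even first factor suffices to reach generators of both parities. *)
Lemma br_nil_gen b (i k j : 'I_n) : (i < k)%N -> (k < j)%N ->
  lsa_br (nil_gen false i k) (nil_gen b k j) = nil_gen b i j.
Proof.
move=> ik kj; apply: val_inj; rewrite /= (sub_brE (nil_subalgebra F n)).
have ij := ltn_trans ik kj; have nij : i != j by rewrite neq_ltn ij.
rewrite !nil_gen_val //; case: b; [exact: br_EtildeEbar | exact: br_Etilde].
Qed.

Lemma block_coord_gen b c (i j k l : 'I_n) : (k < l)%N ->
  block_coord b i j (nil_gen c k l) = [&& b == c, i == k & j == l]%:R.
Proof.
move=> kl; rewrite /block_coord nil_gen_val // EtildeE EbarE.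
by case: b; case: c; rewrite ?(block_mxEur, block_mxEul) !mxE.
Qed.

Lemma nil_gen_form0 (f : nil -> F^o) : linear f ->
  (forall b (i j : 'I_n), (i < j)%N -> f (nil_gen b i j) = 0) -> forall x, f x = 0.
Proof.
(* Pulled back to [gl], the claim says that the kernel contains [nil_space], which is checked on the
   spanning lines. *)
move=> fL f0 x; pose g := fun X : gl => f (vsproj (nil_space F n) X).
have gL : linear g by move=> a X Y; rewrite /g linearP fL.
pose h := GRing.isLinear.Build F gl F^o _ g gL.
pose g' : {linear gl -> F^o} := HB.pack g h.
rewrite -(vsvalK x) -[LHS](lfunE g'); apply/eqP; rewrite -memv_ker.
apply: subvP (subvsP x); apply/subv_sumP => -[i j] /= ij.
have linE X : linfun g X = f (vsproj _ X) by exact: (lfunE g').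
rewrite subv_add -!memvE !memv_ker !linE.
by apply/andP; split; apply/eqP; [exact: (f0 false) | exact: (f0 true)].
Qed.

End Nilradical.

(** * The superdiagonal generators and the dimension count *)

Lemma nil_superdiag_form0 (F : numFieldType) m (f : nil_lsa F m.+1 -> F^o) :
    linear f -> (forall x y, f (lsa_br x y) = 0) ->
    (forall b (i : 'I_m), f (nil_gen F b (widen_ord (leqnSn m) i) (lift ord0 i)) = 0) ->
  forall x, f x = 0.
Proof.
move=> fL f_br f0; apply: nil_gen_form0 => // b i j ij.
have im : (i < m)%N by apply: leq_trans ij _; rewrite -ltnS.
(* This is i + 1: either j equals it, or it lies strictly between i and j and the generator is a
   bracket. *)
pose k := lift ord0 (Ordinal im).
have ik : i = widen_ord (leqnSn m) (Ordinal im) by apply: val_inj.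
have [jk|jk] := eqVneq j k; first by rewrite jk ik; apply: f0.
rewrite -(@br_nil_gen _ _ b i k j) //.
by move: ij; rewrite leq_eqVlt => /predU1P[] // ji; case/eqP: jk; apply: val_inj.
Qed.

Theorem mainTheorem6 (R : realType) (n : nat) (hn : (2 <= n)%N) :
  has_dim (cohomology (nil_lsa R[i] n) 1) (2 * (n - 1))%N.
Proof.
case: n hn => // m _; rewrite subSS subn0.
(* The basis is indexed by a parity and one of the m superdiagonal positions. *)
have -> : (2 * m)%N = #|{: bool * 'I_m}| by rewrite card_prod card_bool card_ord.
pose w (i : 'I_m) := widen_ord (leqnSn m) i.
apply: (@cohomology1_has_dim _ _ _
  (fun p => nil_gen _ p.1 (w p.2) (lift ord0 p.2))
  (fun p => block_coord p.1 (w p.2) (lift ord0 p.2))) => [p|p x y|p q|f fL f_br f0].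
- exact: block_coord_linear.
- exact: block_coord_br.
(* On the superdiagonal the row and column conditions coincide. *)
- rewrite block_coord_gen // (inj_eq lift_inj) -val_eqE /= andbb.
  by case: p q => [b i] [c j].
- by apply: nil_superdiag_form0 => // b i; apply: (f0 (b, i)).
Qed.
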